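(* Let $a\ge 1$, $p\ge 1$, $q\ge 0$, $r\ge 0$ be integers. Then $$\int_{0}^{1}\frac{x^{a}\ln^{q}(x)\left(\frac{\arctan x}{x}\right)^{p}}{(1+x^{2})^{r}}\,dx=\frac{(-1)^{q}q!\,\Gamma(p+1)}{2^{p}}\sum_{k=0}^{\infty}\frac{(-1)^{k}\Gamma(r+k)}{\Gamma(k+1)\Gamma(r)}\sum_{n=0}^{\infty}\frac{(-1)^{n}t_{n}(p-1)}{\left(n+\frac{p}{2}\right)(a+2k+2n+1)^{q+1}}.$$
   Context: Milgram constants: for integers $m\ge1$ and $n\ge0$, $$t_{n}(m)=\sum_{k_{m}=0}^{n}\frac{1}{k_{m}+\frac{m}{2}}\sum_{k_{m-1}=0}^{k_{m}}\frac{1}{k_{m-1}+\frac{m-1}{2}}\cdots\sum_{k_{2}=0}^{k_{3}}\frac{1}{k_{2}+1}\sum_{k_{1}=0}^{k_{2}}\frac{1}{k_{1}+\frac{1}{2}},$$ and $t_n(0)=1$ (empty nested sum). The coefficient $\frac{\Gamma(r+k)}{\Gamma(k+1)\Gamma(r)}$ stands for the binomial coefficient $\binom{r+k-1}{k}$ appearing in $(1+y)^{-r}=\sum_{k\ge0}(-1)^k\binom{r+k-1}{k}y^k$ (so it equals $1$ for $k=0$ and $0$ for $k\ge1$ when $r=0$).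
   Formalization: The outer series over k diverges when r ≥ q+2 (e.g. q=0, r=2), so the identity is proved with ordinary sums for r ≤ q+1 (convergence included) and whenever the outer series converges, and for every r with the outer sum over k taken as an Abel sum. *)

(* Defs.v *)
From Stdlib Require Import Reals Factorial.
From Coquelicot Require Import Coquelicot.
Open Scope R_scope.

(** Milgram constants t_n(m); [sum_n u n] is u 0 + ... + u n. *)
Fixpoint milgram (m n : nat) : R :=
  match m with
  | O => 1
  | S m' => sum_n (fun k => 1 / (INR k + INR m / 2) * milgram m' k) n
  end.

Fixpoint falling (z : R) (k : nat) : R :=
  match k with
  | O => 1
  | S k' => falling z k' * (z - INR k')
  end.

Definition gbinom (z : R) (k : nat) : R := falling z k / INR (fact k).

(** Gamma(r+k) / (Gamma(k+1) Gamma(r)), read as binom(r+k-1, k).  The upper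
    argument is a real number, so that r = 0 gives 1 for k = 0 and 0 for
    k >= 1; truncated subtraction on [nat], or Stdlib's [C], would not. *)
Definition gamma_coef (r k : nat) : R := gbinom (INR r + INR k - 1) k.

(** The value at 0 is a dummy one; the integrand tends to 0 there
    when a >= 1. *)
Definition integrand (a p q r : nat) (x : R) : R :=
  x ^ a * ln x ^ q * (atan x / x) ^ p / (1 + x ^ 2) ^ r.

Definition inner_term (a p q k n : nat) : R :=
  (-1) ^ n * milgram (p - 1) n
  / ((INR n + INR p / 2) * INR (a + 2 * k + 2 * n + 1) ^ (q + 1)).

Definition outer_term (a p q r k : nat) : R :=
  (-1) ^ k * gamma_coef r k * Series (inner_term a p q k).

Definition prefactor (p q : nat) : R :=
  (-1) ^ q * INR (fact q) * INR (fact p) / 2 ^ p.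

(** The series of general term [u] is Abel summable with sum [l]. *)
Definition is_abel_sum (u : nat -> R) (l : R) : Prop :=
  (forall y : R, 0 <= y < 1 -> ex_pseries u y) /\
  filterlim (PSeries u) (at_left 1) (locally l).

(* Main.v *)
(** The idea is to apply the same Abel summation principle twice.  If [phi] and [g] are
    continuous on [0, 1] and [g x = sum b_n x^(2n)] for [0 <= x < 1], then
    [sum b_n y^n int phi x^(2n) = int phi(x) g(sqrt y x)] for [0 <= y < 1] by uniform
    convergence, and the right-hand side tends to [int phi g] as [y -> 1-], by uniform
    continuity of [g].

    With [phi = x^(a+2k) ln^q x] and [g] Milgram's expansion of [(2 atan x / x)^p / p!]
    (obtained by differentiating [atan^p]), this evaluates the inner series, which converges
    absolutely because [t_n(m) = O(sqrt n)].  With [phi = x^a ln^q x (atan x / x)^p] and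
    [g = (1 + x^2)^(-r)] it gives the Abel sum of the outer series; Abel's limit theorem
    handles the case where that series converges.  When [r <= q + 1] its terms are
    [(-1)^k v_k] with [v_k = O(1/k)] and [v_k - v_(k+1) = O(1/k^2)], hence it converges. *)

Require Import Defs.
From Stdlib Require Import Reals Factorial Lra Lia.
From Coquelicot Require Import Coquelicot.
Open Scope R_scope.

(** * Power series and Abel summation *)

Lemma INR_S_pos (n : nat) : 0 < INR n + 1.
Proof. pose proof (pos_INR n); lra. Qed.

Lemma CV_radius_poly_weight (d : nat) :
  CV_radius (fun n => (INR n + 1) ^ d) = Finite 1.
Proof.
  rewrite (CV_radius_finite_DAlembert _ 1); [ now rewrite Rinv_1 | | lra | ].
  - intros n; apply pow_nonzero; pose proof (INR_S_pos n); lra.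
  - apply is_lim_seq_ext with (fun n => (1 + / (INR n + 1)) ^ d).
    + intros n; pose proof (INR_S_pos n) as Hn.
      replace ((INR (S n) + 1) ^ d) with ((1 + / (INR n + 1)) ^ d * (INR n + 1) ^ d).
      * assert (0 < / (INR n + 1)) by now apply Rinv_0_lt_compat.
        unfold Rdiv; rewrite Rmult_assoc, Rinv_r, Rmult_1_r.
        -- rewrite Rabs_pos_eq; trivial; apply pow_le; lra.
        -- apply pow_nonzero; lra.
      * rewrite <- Rpow_mult_distr, S_INR; f_equal; field; lra.
    + replace (Finite 1) with (Finite ((1 + 0) ^ d))
        by (now rewrite Rplus_0_r, pow1).
      apply (is_lim_seq_continuous (fun x => (1 + x) ^ d)).
      * apply continuity_pt_filterlim, (ex_derive_continuous (fun x => (1 + x) ^ d)).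
        auto_derive; trivial.
      * apply is_lim_seq_ext with (fun n => / INR (S n)).
        -- intros n; now rewrite S_INR.
        -- apply (is_lim_seq_incr_1 (fun n => / INR n)).
           apply (is_lim_seq_inv _ p_infty); [ apply is_lim_seq_INR | easy ].
Qed.

(** If the radius were some [s < 1], then at the midpoint [x] of [s] and 1 the terms [b n * x ^ n]
    would be bounded by those of the convergent series of [(n+1)^d x^n], forcing [x <= s]. All
    coefficient sequences below have at most polynomial growth, so this one criterion serves them
    all. *)
Lemma CV_radius_ge_1 (b : nat -> R) (C : R) (d : nat) :
  (forall n, Rabs (b n) <= C * (INR n + 1) ^ d) -> Rbar_le 1 (CV_radius b).
Proof.
  intros Hb.
  apply Rbar_not_lt_le; intros Hlt.
  destruct (CV_radius_bounded b) as [Hub _].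
  pose proof (CV_radius_ge_0 b) as H0.
  destruct (CV_radius b) as [s | | ]; simpl in Hlt, H0; try easy.
  set (x := (s + 1) / 2).
  assert (Hx : 0 <= x < 1) by (unfold x; lra).
  enough (Hle : Rbar_le x s) by (simpl in Hle; unfold x in Hle; lra).
  apply Hub.
  assert (Hex : ex_series (fun n => Rabs (((INR n + 1) ^ d) * x ^ n))).
  { apply (CV_disk_inside (fun n => (INR n + 1) ^ d)).
    rewrite CV_radius_poly_weight, Rabs_pos_eq; simpl; lra. }
  destruct (filterlim_bounded _ (ex_intro _ 0 (ex_series_lim_0 _ Hex))) as [M HM].
  exists (Rabs C * M); intros n.
  rewrite Rabs_mult.
  specialize (HM n); unfold norm in HM; simpl in HM; unfold abs in HM; simpl in HM.
  rewrite Rabs_Rabsolu, Rabs_mult in HM.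
  apply Rle_trans with (Rabs C * (Rabs ((INR n + 1) ^ d) * Rabs (x ^ n))).
  - rewrite <- Rmult_assoc; apply Rmult_le_compat_r; [ apply Rabs_pos | ].
    rewrite <- Rabs_mult.
    apply Rle_trans with (1 := Hb n), Rle_abs.
  - apply Rmult_le_compat_l; [ apply Rabs_pos | exact HM ].
Qed.

Lemma Rbar_lt_CV_radius (b : nat -> R) (y : R) :
  Rbar_le 1 (CV_radius b) -> 0 <= y < 1 -> Rbar_lt (Rabs y) (CV_radius b).
Proof.
  intros Hb Hy; apply Rbar_lt_le_trans with (2 := Hb).
  rewrite Rabs_pos_eq; simpl; lra.
Qed.

(** The bound does not depend on [z]: this is the uniform convergence that allows integrating term
    by term. *)
Lemma PSeries_tail_le (b : nat -> R) (y z : R) (N : nat) :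
  Rbar_lt (Rabs y) (CV_radius b) -> Rabs z <= Rabs y ->
  Rabs (PSeries b z - sum_n (fun n => b n * z ^ n) N)
  <= Series (fun n => Rabs (b n * y ^ n)) - sum_n (fun n => Rabs (b n * y ^ n)) N.
Proof.
  intros Hy Hz.
  assert (Ey := CV_disk_inside b y Hy).
  assert (Ez : ex_series (fun n => Rabs (b n * z ^ n))).
  { apply (CV_disk_inside b z), Rbar_le_lt_trans with (2 := Hy); exact Hz. }
  unfold PSeries.
  rewrite (Series_incr_n _ (S N)) by (try lia; now apply ex_series_Rabs).
  rewrite (Series_incr_n (fun n => Rabs (b n * y ^ n)) (S N)) by (try lia; easy).
  simpl Nat.pred; rewrite <- !sum_n_Reals.
  match goal with |- Rabs (?s + ?t - ?s) <= ?u + ?v - ?u =>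
    replace (s + t - s) with t by ring; replace (u + v - u) with v by ring end.
  assert (Ez' := proj1 (ex_series_incr_n _ (S N)) Ez).
  assert (Ey' := proj1 (ex_series_incr_n _ (S N)) Ey).
  apply Rle_trans with (1 := Series_Rabs _ Ez').
  apply Series_le; [ | exact Ey' ].
  intros n; split; [ apply Rabs_pos | ].
  rewrite !Rabs_mult; apply Rmult_le_compat_l; [ apply Rabs_pos | ].
  rewrite <- !RPow_abs; apply pow_incr; split; [ apply Rabs_pos | exact Hz ].
Qed.

Lemma ex_pseries_Rmult (u : nat -> R) (y : R) :
  ex_series (fun n => u n * y ^ n) -> ex_pseries u y.
Proof.
  apply ex_series_ext; intros n.
  rewrite <- (pow_n_pow y n); apply Rmult_comm.
Qed.

Lemma is_abel_sum_scal (c : R) (u : nat -> R) (l : R) :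
  is_abel_sum u l -> is_abel_sum (fun n => c * u n) (c * l).
Proof.
  intros [Hex Hlim]; split.
  - intros y Hy; apply (ex_pseries_scal c u y); [ apply (Rmult_comm y c) | now apply Hex ].
  - apply filterlim_ext with (fun y => c * PSeries u y).
    + intros y; rewrite <- PSeries_scal; now apply PSeries_ext.
    + apply (filterlim_comp _ _ _ (PSeries u) (fun z => c * z) _ (locally l)); trivial.
      apply (filterlim_scal_r c l).
Qed.

Lemma is_abel_sum_ext (u v : nat -> R) (l : R) :
  (forall n, u n = v n) -> is_abel_sum u l -> is_abel_sum v l.
Proof.
  intros H [Hex Hlim]; split.
  - intros y Hy; now apply (ex_pseries_ext u), Hex.
  - apply filterlim_ext with (PSeries u); trivial.
    intros y; now apply PSeries_ext.
Qed.

(** The terms of a convergent series tend to 0, so the radius is at least 1. If it exceeds 1, the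
    power series is continuous at 1; if it equals 1, Abel's limit theorem applies. Limits being
    unique, the sum is [l]. *)
Lemma is_abel_sum_Series (u : nat -> R) (l : R) :
  is_abel_sum u l -> ex_series u -> Series u = l.
Proof.
  intros [_ Hlim] Hu.
  assert (Hrad : Rbar_le 1 (CV_radius u)).
  { apply Rbar_not_lt_le; intros Hlt.
    apply (CV_disk_outside u 1).
    - now rewrite Rabs_R1.
    - apply is_lim_seq_ext with u; [ intros n; rewrite pow1; ring | ].
      now apply ex_series_lim_0. }
  assert (HS : PSeries u 1 = Series u).
  { apply Series_ext; intros n; rewrite pow1; ring. }
  rewrite <- HS.
  apply (@filterlim_locally_unique _ _ R_NormedModule (at_left 1)
           (Proper_StrongProper _ (at_left_proper_filter 1)) (PSeries u)); [ | exact Hlim ].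
  destruct (Rbar_le_lt_or_eq_dec _ _ Hrad) as [Hlt | Heq].
  - eapply filterlim_filter_le_1; [ apply filter_le_within | ].
    apply continuity_pt_filterlim, PSeries_continuity; now rewrite Rabs_R1.
  - assert (HA := Abel u); rewrite <- Heq in HA; apply HA; simpl; try lra; trivial.
    apply ex_pseries_Rmult, ex_series_ext with u; trivial.
    intros n; rewrite pow1; symmetry; apply Rmult_1_r.
Qed.

(** * Abel sums of moments *)

Lemma ex_RInt_continuous_01 (f : R -> R) :
  (forall x, 0 <= x <= 1 -> continuous f x) -> ex_RInt f 0 1.
Proof.
  intros Hf; apply (ex_RInt_continuous f); intros x.
  rewrite Rmin_left, Rmax_right by lra; apply Hf.
Qed.

Lemma bounded_continuous_01 (f : R -> R) :
  (forall x, 0 <= x <= 1 -> continuous f x) ->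
  exists M, 0 < M /\ forall x, 0 <= x <= 1 -> Rabs (f x) <= M.
Proof.
  intros Hf; destruct (bounded_continuity f 0 1 Hf) as [M HM].
  exists M; split.
  - apply Rle_lt_trans with (Rabs (f 0)); [ apply Rabs_pos | apply HM; lra ].
  - intros x Hx; left; now apply HM.
Qed.

Lemma continuous_Rmult (f g : R -> R) (x : R) :
  continuous f x -> continuous g x -> continuous (fun t => f t * g t) x.
Proof. apply (continuous_mult f g). Qed.

Lemma continuous_pow_comp (f : R -> R) (n : nat) (x : R) :
  continuous f x -> continuous (fun t => f t ^ n) x.
Proof.
  intros Hf; induction n as [ | n IH ]; simpl.
  - apply continuous_const.
  - now apply continuous_Rmult.
Qed.

Lemma continuous_pow (n : nat) (x : R) : continuous (fun t => t ^ n) x.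
Proof. apply (continuous_pow_comp (fun t => t)), continuous_id. Qed.

(** Only even powers occur, because every expansion used is a power series in [x ^ 2]. *)
Definition moment (phi : R -> R) (n : nat) : R :=
  RInt (fun x => phi x * x ^ (2 * n)) 0 1.

Section Moments.

Variables (b : nat -> R) (phi g : R -> R).
Hypothesis b_radius : Rbar_le 1 (CV_radius b).
Hypothesis phi_cont : forall x, 0 <= x <= 1 -> continuous phi x.
Hypothesis g_cont : forall x, 0 <= x <= 1 -> continuous g x.
Hypothesis g_PSeries : forall x, 0 <= x < 1 -> g x = PSeries b (x ^ 2).

Lemma is_RInt_moment (n : nat) :
  is_RInt (fun x => phi x * x ^ (2 * n)) 0 1 (moment phi n).
Proof.
  apply (RInt_correct (fun x => phi x * x ^ (2 * n))), ex_RInt_continuous_01; intros x Hx.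
  apply continuous_Rmult; [ now apply phi_cont | apply continuous_pow ].
Qed.

Lemma is_RInt_partial_sum (y : R) (N : nat) :
  is_RInt (fun x => phi x * sum_n (fun n => b n * (y * x ^ 2) ^ n) N) 0 1
    (sum_n (fun n => b n * moment phi n * y ^ n) N).
Proof.
  assert (Hterm : forall n,
    is_RInt (fun x => phi x * (b n * (y * x ^ 2) ^ n)) 0 1 (b n * moment phi n * y ^ n)).
  { intros n; replace (b n * moment phi n * y ^ n)
      with (scal (b n * y ^ n) (moment phi n))
      by (unfold scal; simpl; unfold mult; simpl; ring).
    apply is_RInt_ext with (fun x => scal (b n * y ^ n) (phi x * x ^ (2 * n))).
    - intros x _.
      change (b n * y ^ n * (phi x * x ^ (2 * n)) = phi x * (b n * (y * x ^ 2) ^ n)).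
      rewrite Rpow_mult_distr, <- (pow_mult x 2 n); ring.
    - apply (is_RInt_scal (V := R_NormedModule)), is_RInt_moment. }
  induction N as [ | N IH ].
  - rewrite sum_O; apply is_RInt_ext with (2 := Hterm O).
    intros x _; now rewrite sum_O.
  - rewrite sum_Sn.
    apply is_RInt_ext with (fun x =>
      plus (phi x * sum_n (fun n => b n * (y * x ^ 2) ^ n) N)
           (phi x * (b (S N) * (y * x ^ 2) ^ S N))).
    + intros x _; rewrite sum_Sn; unfold plus; simpl; ring.
    + now apply (is_RInt_plus (V := R_NormedModule)).
Qed.

Lemma sqrt_mult_01 (y x : R) : 0 <= y <= 1 -> 0 <= x <= 1 -> 0 <= sqrt y * x <= sqrt y.
Proof.
  intros Hy Hx; pose proof (sqrt_pos y); nra.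
Qed.

Lemma ex_RInt_dilated (y : R) : 0 <= y <= 1 ->
  ex_RInt (fun x => phi x * g (sqrt y * x)) 0 1.
Proof.
  intros Hy; apply ex_RInt_continuous_01; intros x Hx.
  apply continuous_Rmult; [ now apply phi_cont | ].
  apply (continuous_comp (fun x => sqrt y * x) g).
  - apply (continuous_Rmult (fun _ => sqrt y)); [ apply continuous_const | apply continuous_id ].
  - apply g_cont.
    assert (H := sqrt_mult_01 y x Hy Hx).
    assert (sqrt y <= 1) by (rewrite <- sqrt_1; apply sqrt_le_1; lra).
    lra.
Qed.

(** The dilation keeps [sqrt y * x] below 1 even at [x = 1], where the expansion of [g] is not
    assumed. Since [(sqrt y * x)^2 = y x^2 <= y], the error of the partial sums is at most [M] times
    the absolute tail at [y]. *)
Lemma is_series_dilated (y : R) : 0 <= y < 1 ->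
  is_series (fun n => b n * moment phi n * y ^ n) (RInt (fun x => phi x * g (sqrt y * x)) 0 1).
Proof.
  intros Hy.
  destruct (bounded_continuous_01 phi phi_cont) as [M [HM0 HM]].
  assert (Hrad := Rbar_lt_CV_radius b y b_radius Hy).
  assert (Htail : is_lim_seq (fun N => M * (Series (fun n => Rabs (b n * y ^ n))
                                - sum_n (fun n => Rabs (b n * y ^ n)) N)) 0).
  { replace (Finite 0) with (Rbar_mult M (Finite 0)) by (simpl; f_equal; ring).
    apply is_lim_seq_scal_l.
    replace 0 with (Series (fun n => Rabs (b n * y ^ n)) - Series (fun n => Rabs (b n * y ^ n)))
      by ring.
    apply is_lim_seq_minus'; [ apply is_lim_seq_const | ].
    now apply (Series_correct (fun n => Rabs (b n * y ^ n))), CV_disk_inside. }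
  change (is_lim_seq (sum_n (fun n => b n * moment phi n * y ^ n))
            (RInt (fun x => phi x * g (sqrt y * x)) 0 1)).
  apply is_lim_seq_ext with (fun N => RInt (fun x => phi x * g (sqrt y * x)) 0 1
    + (sum_n (fun n => b n * moment phi n * y ^ n) N
       - RInt (fun x => phi x * g (sqrt y * x)) 0 1)); [ intros; ring | ].
  rewrite <- (Rplus_0_r (RInt _ _ _)) at 1.
  apply is_lim_seq_plus'; [ apply is_lim_seq_const | ].
  apply is_lim_seq_abs_0, is_lim_seq_le_le with (u := fun _ => 0) (3 := Htail);
    [ | apply is_lim_seq_const ].
  intros N; split; [ apply Rabs_pos | ].
  assert (HI := is_RInt_minus _ _ _ _ _ _ (is_RInt_partial_sum y N)
                  (RInt_correct _ _ _ (ex_RInt_dilated y (conj (proj1 Hy) (Rlt_le _ _ (proj2 Hy)))))).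
  unfold minus, plus, opp in HI; simpl in HI.
  unfold Rminus at 1; rewrite <- (is_RInt_unique _ _ _ _ HI).
  match goal with |- _ <= ?X => replace X with ((1 - 0) * X) by ring end.
  apply abs_RInt_le_const; [ lra | eexists; exact HI | ].
  intros x Hx.
  assert (Hyx := sqrt_mult_01 y x (conj (proj1 Hy) (Rlt_le _ _ (proj2 Hy))) Hx).
  assert (Hsy : sqrt y < 1) by (rewrite <- sqrt_1; apply sqrt_lt_1; lra).
  rewrite g_PSeries by lra.
  replace ((sqrt y * x) ^ 2) with (y * x ^ 2)
    by (rewrite Rpow_mult_distr, pow2_sqrt by lra; reflexivity).
  match goal with |- Rabs (?p * ?s + - (?p * ?t)) <= _ =>
    replace (p * s + - (p * t)) with (- (p * (t - s))) by ring end.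
  rewrite Rabs_Ropp, Rabs_mult.
  apply Rmult_le_compat; try apply Rabs_pos; [ now apply HM | ].
  apply PSeries_tail_le; trivial.
  assert (0 <= x ^ 2 <= 1) by (split; nra).
  rewrite !Rabs_pos_eq; nra.
Qed.

Lemma abel_sum_moments :
  is_abel_sum (fun n => b n * moment phi n) (RInt (fun x => phi x * g x) 0 1).
Proof.
  split.
  - intros y Hy; apply ex_pseries_Rmult.
    eexists; now apply is_series_dilated.
  - destruct (bounded_continuous_01 phi phi_cont) as [M [HM0 HM]].
    apply filterlim_locally; intros eps.
    assert (Heps : 0 < eps / (2 * M)).
    { apply Rdiv_lt_0_compat; [ apply cond_pos | lra ]. }
    destruct (unifcont_normed_1d g 0 1 g_cont (mkposreal _ Heps)) as [delta Hdelta].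
    simpl in Hdelta.
    (* The cap at 1 makes [y] positive, so that [sqrt y] behaves as expected. *)
    assert (Hd : 0 < Rmin delta 1) by (apply Rmin_pos; [ apply cond_pos | lra ]).
    exists (mkposreal _ Hd); intros y Hball Hy1; simpl in Hball.
    assert (Hy : 1 - y < delta /\ 0 < y).
    { unfold ball in Hball; simpl in Hball; unfold AbsRing_ball, abs, minus, plus, opp in Hball;
        simpl in Hball.
      rewrite Rabs_left1 in Hball by lra.
      pose proof (Rmin_l delta 1); pose proof (Rmin_r delta 1); lra. }
    assert (Hy01 : 0 <= y < 1) by lra.
    replace (PSeries (fun n => b n * moment phi n) y)
      with (RInt (fun x => phi x * g (sqrt y * x)) 0 1)
      by (symmetry; apply is_series_unique, (is_series_dilated y Hy01)).
    assert (Hone : ex_RInt (fun x => phi x * g x) 0 1).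
    { apply ex_RInt_continuous_01; intros x Hx; apply continuous_Rmult; auto. }
    assert (HI := is_RInt_minus _ _ _ _ _ _ (RInt_correct _ _ _ (ex_RInt_dilated y (conj (proj1 Hy01) (Rlt_le _ _ (proj2 Hy01)))))
                    (RInt_correct _ _ _ Hone)).
    unfold minus, plus, opp in HI; simpl in HI.
    change (Rabs (RInt (fun x => phi x * g (sqrt y * x)) 0 1
              + - RInt (fun x => phi x * g x) 0 1) < eps).
    rewrite <- (is_RInt_unique _ _ _ _ HI).
    apply Rle_lt_trans with ((1 - 0) * (eps / 2));
      [ | pose proof (cond_pos eps); lra ].
    apply abs_RInt_le_const; [ lra | eexists; exact HI | ].
    intros x Hx.
    assert (Hyx := sqrt_mult_01 y x (conj (proj1 Hy01) (Rlt_le _ _ (proj2 Hy01))) Hx).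
    assert (Hsy : sqrt y < 1) by (rewrite <- sqrt_1; apply sqrt_lt_1; lra).
    (* Hence [x - sqrt y * x <= 1 - y < delta] for all [x] in the interval. *)
    assert (Hyy : y <= sqrt y).
    { rewrite <- (sqrt_sqrt y) at 1 by lra; pose proof (sqrt_pos y); nra. }
    match goal with |- Rabs (?p * ?s + - (?p * ?t)) <= _ =>
      replace (p * s + - (p * t)) with (p * (s - t)) by ring end.
    rewrite Rabs_mult.
    replace (eps / 2) with (M * (eps / (2 * M))) by (field; lra).
    apply Rmult_le_compat; try apply Rabs_pos; [ now apply HM | ].
    left; apply (Hdelta x (sqrt y * x)); try lra.
    change (Rabs (sqrt y * x - x) < delta).
    rewrite Rabs_left1; nra.
Qed.

End Moments.

(** * Logarithmic moments *)

Definition pow_ln (m q : nat) (x : R) : R := x ^ m * ln x ^ q.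

Lemma ln_nonpos_0 (x : R) : x <= 0 -> ln x = 0.
Proof. intros Hx; unfold ln; destruct (Rlt_dec 0 x); [ exfalso; lra | reflexivity ]. Qed.

Lemma ln_01_nonpos (x : R) : 0 <= x <= 1 -> ln x <= 0.
Proof.
  intros [[Hx | <-] H1].
  - rewrite <- ln_1; now apply ln_le.
  - rewrite ln_nonpos_0; lra.
Qed.

(** With [u = t / (n+1)], the bound [u <= 1 + u <= exp u] is raised to the power [n]. Dividing by
    [n + 1] rather than [n] avoids an exception at [n = 0]. At [t = - ln z] this shows that a factor
    [z] absorbs any power of the logarithm. *)
Lemma exp_ge_pow (t : R) (n : nat) : 0 <= t -> (t / (INR n + 1)) ^ n <= exp t.
Proof.
  intros Ht; set (u := t / (INR n + 1)).
  assert (Hn := INR_S_pos n).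
  assert (Hu : 0 <= u) by (apply Rdiv_le_0_compat; lra).
  assert (Hpow : forall k, u ^ k <= exp (INR k * u)).
  { induction k as [ | k IH ].
    - simpl; rewrite Rmult_0_l, exp_0; lra.
    - rewrite S_INR, Rmult_plus_distr_r, Rmult_1_l, exp_plus, (Rmult_comm (exp _)); simpl.
      apply Rmult_le_compat; [ exact Hu | now apply pow_le | | exact IH ].
      apply Rle_trans with (1 + u); [ lra | apply exp_ineq1_le ]. }
  replace t with (INR n * u + u) at 1 by (unfold u; field; lra).
  apply Rle_trans with (1 := Hpow n).
  destruct Hu as [Hu | <-]; [ left; apply exp_increasing; lra | right; f_equal; ring ].
Qed.

Lemma mult_ln_pow_le (q : nat) (z : R) :
  0 < z <= 1 -> z * (- ln z) ^ q <= (INR q + 1) ^ q.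
Proof.
  intros Hz; assert (Hn := INR_S_pos q).
  assert (Hl := ln_01_nonpos z (conj (Rlt_le _ _ (proj1 Hz)) (proj2 Hz))).
  assert (H := exp_ge_pow (- ln z) q ltac:(lra)).
  rewrite exp_Ropp, exp_ln in H by lra.
  unfold Rdiv in H; rewrite Rpow_mult_distr, pow_inv in H.
  assert (Hq : 0 < (INR q + 1) ^ q) by now apply pow_lt.
  apply (Rmult_le_compat_l z) in H; [ | lra ].
  rewrite Rinv_r in H by lra.
  apply (Rmult_le_compat_r ((INR q + 1) ^ q)) in H; [ | lra ].
  rewrite Rmult_1_l in H; apply Rle_trans with (2 := H).
  right; field; lra.
Qed.

(* Splitting x as sqrt x * sqrt x leaves one factor to absorb the logarithm. *)
Lemma mult_ln_pow_le_sqrt (q : nat) (x : R) :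
  Rabs x <= 1 -> Rabs (x * ln x ^ q) <= (2 * (INR q + 1)) ^ q * sqrt (Rabs x).
Proof.
  intros Hx.
  assert (Hn := INR_S_pos q).
  assert (Hs : sqrt (Rabs x) <= 1).
  { rewrite <- sqrt_1; apply sqrt_le_1; trivial; [ apply Rabs_pos | lra ]. }
  assert (Hs0 := sqrt_pos (Rabs x)).
  assert (Hss := sqrt_sqrt _ (Rabs_pos x)).
  rewrite Rabs_mult, <- RPow_abs; rewrite <- Hss at 1.
  destruct (Rle_or_lt x 0) as [Hneg | Hpos].
  (* Continuity at 0 is two-sided, so negative [x] matter. There [ln x] is 0 by convention and
     [0 ^ q] is 0 or 1, hence the check that the constant is at least 1. *)
  - rewrite (ln_nonpos_0 x Hneg), Rabs_R0.
    assert (Hone : 1 <= (2 * (INR q + 1)) ^ q) by (apply pow_R1_Rle; pose proof (pos_INR q); lra).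
    assert (Hz : 0 <= 0 ^ q <= 1).
    { destruct q; simpl; [ lra | rewrite Rmult_0_l; lra ]. }
    assert (sqrt (Rabs x) * 0 ^ q <= (2 * (INR q + 1)) ^ q) by nra.
    nra.
  - rewrite (Rabs_pos_eq x) in * by lra.
    assert (Hsp : 0 < sqrt x) by now apply sqrt_lt_R0.
    assert (Hln : ln x = 2 * ln (sqrt x)).
    { rewrite <- Hss at 1; rewrite ln_mult by trivial; ring. }
    assert (Hl := ln_01_nonpos (sqrt x) ltac:(lra)).
    rewrite Hln, Rabs_left1 by lra.
    replace (- (2 * ln (sqrt x))) with (2 * - ln (sqrt x)) by ring.
    rewrite !Rpow_mult_distr.
    assert (H := mult_ln_pow_le q (sqrt x) ltac:(lra)).
    assert (0 < 2 ^ q) by (apply pow_lt; lra).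
    replace (sqrt x * sqrt x * (2 ^ q * (- ln (sqrt x)) ^ q))
      with (2 ^ q * sqrt x * (sqrt x * (- ln (sqrt x)) ^ q)) by ring.
    replace (2 ^ q * (INR q + 1) ^ q * sqrt x) with (2 ^ q * sqrt x * (INR q + 1) ^ q) by ring.
    apply Rmult_le_compat_l; [ nra | exact H ].
Qed.

Lemma continuous_pow_ln_0 (q : nat) : continuous (fun x => x * ln x ^ q) 0.
Proof.
  apply filterlim_locally; intros eps.
  set (C := (2 * (INR q + 1)) ^ q).
  assert (HC : 0 < C) by (apply pow_lt; pose proof (pos_INR q); lra).
  assert (He : 0 < eps / C) by (apply Rdiv_lt_0_compat; [ apply cond_pos | exact HC ]).
  assert (Hd : 0 < Rmin 1 ((eps / C) ^ 2)) by (apply Rmin_pos; [ lra | now apply pow_lt ]).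
  exists (mkposreal _ Hd); intros x Hx.
  change (Rabs (x - 0) < Rmin 1 ((eps / C) ^ 2)) in Hx.
  change (Rabs (x * ln x ^ q - 0 * ln 0 ^ q) < eps).
  rewrite Rminus_0_r in Hx.
  rewrite Rmult_0_l, Rminus_0_r.
  apply Rle_lt_trans with (1 := mult_ln_pow_le_sqrt q x ltac:(pose proof (Rmin_l 1 ((eps / C) ^ 2)); lra)).
  fold C; replace (pos eps) with (C * (eps / C)) by (field; lra).
  apply Rmult_lt_compat_l; trivial.
  rewrite <- (sqrt_pow2 (eps / C)) by lra.
  apply sqrt_lt_1; [ apply Rabs_pos | apply pow2_ge_0 | ].
  pose proof (Rmin_r 1 ((eps / C) ^ 2)); lra.
Qed.

Lemma continuous_pow_ln (m q : nat) (x : R) :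
  (1 <= m)%nat -> 0 <= x -> continuous (pow_ln m q) x.
Proof.
  intros Hm [Hx | <-].
  - apply continuous_Rmult; [ apply continuous_pow | ].
    now apply continuous_pow_comp, continuous_ln.
  - apply continuous_ext with (fun x => x ^ (m - 1) * (x * ln x ^ q)).
    + intros x; unfold pow_ln; replace m with (S (m - 1)) at 2 by lia; simpl; ring.
    + apply continuous_Rmult; [ apply continuous_pow | apply continuous_pow_ln_0 ].
Qed.

Lemma pow_ln_0 (m q : nat) : (1 <= m)%nat -> pow_ln m q 0 = 0.
Proof. intros Hm; unfold pow_ln; rewrite pow_i by lia; ring. Qed.

(** The difference quotient of [x * f x] at 0 is [f h] itself. This covers the endpoint 0, where the
    usual rules fail for the logarithm. *)
Lemma is_derive_mult_id_0 (f : R -> R) :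
  continuous f 0 -> is_derive (fun x => x * f x) 0 (f 0).
Proof.
  intros Hf; apply is_derive_Reals; intros eps Heps.
  destruct (proj1 (filterlim_locally f (f 0)) Hf (mkposreal _ Heps)) as [d Hd].
  exists d; intros h Hh0 Hh.
  replace (((0 + h) * f (0 + h) - 0 * f 0) / h - f 0) with (f h - f 0)
    by (rewrite Rplus_0_l; field; trivial).
  apply Hd; change (Rabs (h - 0) < d); now rewrite Rminus_0_r.
Qed.

(** The exponent [S m] leaves a factor [x] to split off at 0, so the derivative exists on all of
    [[0, 1]] and the fundamental theorem applies without an improper integral. *)
Lemma is_derive_pow_ln (m q : nat) (x : R) : (1 <= m)%nat -> 0 <= x ->
  is_derive (pow_ln (S m) (S q)) x
    ((INR m + 1) * pow_ln m (S q) x + (INR q + 1) * pow_ln m q x).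
Proof.
  intros Hm [Hx | <-].
  - unfold pow_ln; auto_derive; trivial.
    change (match m with O => 1 | S _ => INR m + 1 end) with (INR (S m)).
    change (match q with O => 1 | S _ => INR q + 1 end) with (INR (S q)).
    rewrite !S_INR; cbn [pow Nat.pred]; field; lra.
  - rewrite !pow_ln_0 by trivial.
    replace ((INR m + 1) * 0 + (INR q + 1) * 0) with (pow_ln m (S q) 0)
      by (rewrite pow_ln_0 by trivial; ring).
    apply is_derive_ext with (fun x => x * pow_ln m (S q) x).
    + intros x; unfold pow_ln; simpl; ring.
    + apply is_derive_mult_id_0, continuous_pow_ln; trivial; lra.
Qed.

Lemma ex_RInt_pow_ln (m q : nat) : (1 <= m)%nat -> ex_RInt (pow_ln m q) 0 1.
Proof.
  intros Hm; apply ex_RInt_continuous_01; intros x Hx.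
  apply continuous_pow_ln; trivial; lra.
Qed.

(** Integration by parts, by induction on [q]: the derivative of [x^(m+1) ln^(q+1) x] is integrated
    once through its boundary values, both 0, and once term by term. *)
Lemma RInt_pow_ln (m q : nat) : (1 <= m)%nat ->
  RInt (pow_ln m q) 0 1 = (-1) ^ q * INR (fact q) / (INR m + 1) ^ (q + 1).
Proof.
  intros Hm; assert (Hpos := INR_S_pos m).
  induction q as [ | q IH ].
  - rewrite (RInt_ext _ (fun x => x ^ m)).
    + rewrite (is_RInt_unique _ _ _ _ (is_RInt_pow 0 1 m)), pow1, pow_i, S_INR by lia.
      simpl; field; lra.
    + intros x _; unfold pow_ln; simpl; ring.
  - assert (Hd : is_RInt (fun x => (INR m + 1) * pow_ln m (S q) x + (INR q + 1) * pow_ln m q x)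
                   0 1 (minus (pow_ln (S m) (S q) 1) (pow_ln (S m) (S q) 0))).
    { apply (is_RInt_derive (pow_ln (S m) (S q)));
        intros x; rewrite Rmin_left, Rmax_right by lra; intros Hx.
      - apply is_derive_pow_ln; trivial; lra.
      - apply (continuous_plus (fun x => (INR m + 1) * pow_ln m (S q) x));
          (apply (continuous_Rmult (fun _ => _)); [ apply continuous_const | ];
           apply continuous_pow_ln; trivial; lra). }
    assert (Hs : is_RInt (fun x => (INR m + 1) * pow_ln m (S q) x + (INR q + 1) * pow_ln m q x)
      0 1 ((INR m + 1) * RInt (pow_ln m (S q)) 0 1 + (INR q + 1) * RInt (pow_ln m q) 0 1)).
    { apply (is_RInt_plus (V := R_NormedModule));
        apply (is_RInt_scal (V := R_NormedModule)),
        (RInt_correct (V := R_CompleteNormedModule)), ex_RInt_pow_ln, Hm. }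
    assert (Heq := is_RInt_unique _ _ _ _ Hd); rewrite (is_RInt_unique _ _ _ _ Hs) in Heq.
    rewrite pow_ln_0 in Heq by lia.
    unfold pow_ln at 3 in Heq; rewrite ln_1, pow1, pow_i in Heq by lia.
    unfold minus, plus, opp in Heq; simpl in Heq.
    rewrite IH in Heq.
    apply (Rmult_eq_reg_l (INR m + 1)); [ | lra ].
    rewrite fact_simpl, mult_INR, S_INR, Nat.add_succ_l.
    assert (Hnz := pow_nonzero (INR m + 1) (q + 1) ltac:(lra)).
    simpl.
    match type of Heq with ?A + ?B = _ => replace A with (- B) by lra end.
    field; lra.
Qed.

(** * Milgram's expansion of powers of the arctangent *)

Lemma sum_n_S (u : nat -> R) (n : nat) : sum_n u (S n) = sum_n u n + u (S n).
Proof. apply (sum_Sn u n). Qed.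

Lemma half_S_le (m k : nat) : (INR k + 1) / 2 <= INR k + INR (S m) / 2.
Proof. rewrite S_INR; pose proof (pos_INR k); pose proof (pos_INR m); lra. Qed.

(** The right-hand side telescopes when summed over the integers. *)
Lemma inv_sqrt_le (x : R) : 0 <= x -> / sqrt (x + 1) <= 2 * (sqrt (x + 1) - sqrt x).
Proof.
  intros Hx.
  assert (H0 := sqrt_pos x).
  assert (H1 : 0 < sqrt (x + 1)) by (apply sqrt_lt_R0; lra).
  assert (E0 := sqrt_sqrt x Hx); assert (E1 := sqrt_sqrt (x + 1) ltac:(lra)).
  apply (Rmult_le_reg_l (sqrt (x + 1))); trivial.
  rewrite Rinv_r by lra.
  assert (0 <= (sqrt (x + 1) - sqrt x) ^ 2) by apply pow2_ge_0.
  nra.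
Qed.

(** A bound of order [sqrt] reproduces itself: divided by [k + (m+1)/2 >= (k+1)/2], it gives terms
    of order [1 / sqrt (k+1)], whose sum telescopes back to order [sqrt (n+1)], the constant growing
    by a factor 4. *)
Lemma milgram_le_sqrt (m : nat) :
  exists C, 0 < C /\ forall n, 0 <= milgram m n <= C * sqrt (INR n + 1).
Proof.
  induction m as [ | m [C [HC IH]] ].
  - exists 1; split; [ lra | ]; intros n; simpl.
    split; [ lra | ].
    rewrite Rmult_1_l, <- sqrt_1 at 1; apply sqrt_le_1; pose proof (pos_INR n); lra.
  - exists (4 * C); split; [ lra | ].
    assert (Hterm : forall k, 0 <= 1 / (INR k + INR (S m) / 2) * milgram m k
                      <= 4 * C * (sqrt (INR k + 1) - sqrt (INR k))).
    { intros k; destruct (IH k) as [H0 H1].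
      assert (Hk := pos_INR k); assert (Hm := half_S_le m k).
      assert (Hs : 0 < sqrt (INR k + 1)) by (apply sqrt_lt_R0; lra).
      assert (Hi : 0 < / (INR k + INR (S m) / 2)) by (apply Rinv_0_lt_compat; lra).
      unfold Rdiv at 1 3; rewrite Rmult_1_l; split; [ nra | ].
      apply Rle_trans with (2 / (INR k + 1) * (C * sqrt (INR k + 1))).
      - apply Rmult_le_compat; trivial; [ lra | ].
        replace (2 / (INR k + 1)) with (/ ((INR k + 1) / 2)) by (field; lra).
        apply Rinv_le_contravar; lra.
      - assert (Hinv := inv_sqrt_le (INR k) Hk).
        replace (2 / (INR k + 1) * (C * sqrt (INR k + 1))) with (2 * C * / sqrt (INR k + 1)).
        + nra.
        + assert (E := sqrt_sqrt (INR k + 1) ltac:(lra)).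
          rewrite <- E at 2; field; lra. }
    induction n as [ | n IHn ]; cbn [milgram] in *.
    + rewrite sum_O; specialize (Hterm O); change (INR 0) with 0 in *.
      rewrite sqrt_0 in Hterm; rewrite Rminus_0_r in Hterm; exact Hterm.
    + rewrite sum_n_S; specialize (Hterm (S n)).
      assert (E : sqrt (INR (S n)) = sqrt (INR n + 1)) by now rewrite S_INR.
      rewrite E in Hterm; lra.
Qed.

Lemma milgram_0 (m : nat) : milgram m 0 = 2 ^ m / INR (fact m).
Proof.
  induction m as [ | m IH ]; [ simpl; field | ].
  cbn [milgram]; rewrite sum_O, IH, fact_simpl, mult_INR, S_INR.
  pose proof (INR_fact_neq_0 m); pose proof (pos_INR m); simpl; field; lra.
Qed.

Definition milgram_ps (m n : nat) : R := (-1) ^ n * milgram m n.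

(** These will turn out to be the coefficients, in the variable [w = x^2], of
    [(2 atan x / x)^(m+1) / (m+1)!]; the index [m] stands for [p - 1]. *)
Definition atan_ps (m n : nat) : R := milgram_ps m n / (INR n + INR (S m) / 2).

Lemma Rabs_pow_m1 (n : nat) : Rabs ((-1) ^ n) = 1.
Proof. apply pow_1_abs. Qed.

Lemma sqrt_S_le (n : nat) : sqrt (INR n + 1) <= INR n + 1.
Proof.
  pose proof (pos_INR n).
  rewrite <- (sqrt_square (INR n + 1)) at 2 by lra.
  apply sqrt_le_1; nra.
Qed.

Lemma CV_radius_milgram_ps (m : nat) : Rbar_le 1 (CV_radius (milgram_ps m)).
Proof.
  destruct (milgram_le_sqrt m) as [C [HC H]].
  apply (CV_radius_ge_1 _ C 1); intros n.
  unfold milgram_ps; rewrite Rabs_mult, Rabs_pow_m1, Rmult_1_l, pow_1.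
  destruct (H n) as [H0 H1]; rewrite Rabs_pos_eq by trivial.
  pose proof (sqrt_S_le n); nra.
Qed.

Lemma Rabs_atan_ps_le (m : nat) :
  exists C, 0 < C /\ forall n, Rabs (atan_ps m n) <= C * / sqrt (INR n + 1).
Proof.
  destruct (milgram_le_sqrt m) as [C [HC H]].
  exists (2 * C); split; [ lra | ]; intros n.
  destruct (H n) as [H0 H1].
  assert (Hn := INR_S_pos n); assert (Hm := half_S_le m n).
  assert (Hs : 0 < sqrt (INR n + 1)) by (apply sqrt_lt_R0; lra).
  unfold atan_ps, milgram_ps, Rdiv.
  rewrite !Rabs_mult, Rabs_pow_m1, Rmult_1_l, Rabs_inv, !Rabs_pos_eq by lra.
  apply Rle_trans with (C * sqrt (INR n + 1) * / ((INR n + 1) / 2)).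
  - apply Rmult_le_compat; trivial; [ | apply Rinv_le_contravar; lra ].
    left; apply Rinv_0_lt_compat; lra.
  - right; assert (E := sqrt_sqrt (INR n + 1) ltac:(lra)).
    rewrite <- E at 2; field; lra.
Qed.

Lemma CV_radius_atan_ps (m : nat) : Rbar_le 1 (CV_radius (atan_ps m)).
Proof.
  destruct (Rabs_atan_ps_le m) as [C [HC H]].
  apply (CV_radius_ge_1 _ C 0); intros n.
  apply Rle_trans with (1 := H n), Rmult_le_compat_l; [ lra | ].
  simpl; rewrite <- Rinv_1; apply Rinv_le_contravar; [ lra | ].
  rewrite <- sqrt_1 at 1; apply sqrt_le_1; pose proof (pos_INR n); lra.
Qed.

Lemma PSeries_1p_mult (b : nat -> R) (w : R) : ex_pseries b w ->
  (1 + w) * PSeries b w = PSeries (PS_plus b (PS_incr_1 b)) w.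
Proof.
  intros Hb; rewrite PSeries_plus, PSeries_incr_1; trivial; [ ring | ].
  now apply ex_pseries_incr_1.
Qed.

Lemma PSeries_milgram_0 (w : R) : 0 <= w < 1 -> (1 + w) * PSeries (milgram_ps 0) w = 1.
Proof.
  intros Hw.
  replace (PSeries (milgram_ps 0) w) with (/ (1 + w)); [ field; lra | ].
  replace (1 + w) with (1 - (- w)) by ring.
  rewrite <- Series_geom by (rewrite Rabs_Ropp, Rabs_pos_eq; lra).
  apply Series_ext; intros n; unfold milgram_ps; simpl.
  rewrite Rmult_1_r, <- Rpow_mult_distr; f_equal; ring.
Qed.

(** The signs alternate, so multiplying by [1 + w] takes differences of consecutive Milgram
    constants, which undoes their outermost summation. *)
Lemma PSeries_milgram_S (m : nat) (w : R) : 0 <= w < 1 ->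
  (1 + w) * PSeries (milgram_ps (S m)) w = PSeries (atan_ps m) w.
Proof.
  intros Hw.
  rewrite PSeries_1p_mult
    by (apply CV_radius_inside, Rbar_lt_CV_radius; trivial; apply CV_radius_milgram_ps).
  apply PSeries_ext; intros n.
  unfold PS_plus, PS_incr_1, atan_ps, milgram_ps.
  assert (Hm := half_S_le m n); assert (Hn := INR_S_pos n).
  destruct n as [ | n ]; cbn [milgram].
  - rewrite sum_O; unfold plus, zero; cbn -[INR milgram]; field; lra.
  - rewrite sum_n_S; unfold plus; cbn -[INR milgram sum_n]; field; lra.
Qed.

(** Coefficientwise, the operator [(m+1) + 2 w d/dw] multiplies by [2n + m + 1] and so cancels the
    denominator of [atan_ps]. This operator is what differentiating [x^(m+1) A(x^2)] produces. *)
Lemma PSeries_atan_Euler (m : nat) (w : R) : 0 <= w < 1 ->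
  2 * PSeries (milgram_ps m) w
  = INR (S m) * PSeries (atan_ps m) w + 2 * (w * PSeries (PS_derive (atan_ps m)) w).
Proof.
  intros Hw.
  assert (Hr := Rbar_lt_CV_radius _ w (CV_radius_atan_ps m) Hw).
  rewrite <- PSeries_incr_1, <- !PSeries_scal, <- PSeries_plus.
  - apply PSeries_ext; intros n.
    unfold PS_plus, PS_scal, PS_incr_1, PS_derive, atan_ps.
    assert (Hm := half_S_le m n); assert (Hn := INR_S_pos n).
    destruct n as [ | n ].
    + change (2 * milgram_ps m 0
              = INR (S m) * (milgram_ps m 0 / (0 + INR (S m) / 2)) + 2 * 0).
      change (INR 0) with 0 in Hm; field; lra.
    + change (2 * milgram_ps m (S n)
              = INR (S m) * (milgram_ps m (S n) / (INR (S n) + INR (S m) / 2))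
                + 2 * (INR (S n) * (milgram_ps m (S n) / (INR (S n) + INR (S m) / 2)))).
      field; lra.
  - apply ex_pseries_scal; [ apply Rmult_comm | now apply CV_radius_inside ].
  - apply ex_pseries_scal; [ apply Rmult_comm | ].
    apply ex_pseries_incr_1, CV_radius_inside; now rewrite CV_radius_derive.
Qed.

Lemma is_derive_atan_ps (m : nat) (x : R) : 0 <= x < 1 ->
  is_derive (fun x => x ^ S m * PSeries (atan_ps m) (x ^ 2)) x
    (2 * x ^ m * PSeries (milgram_ps m) (x ^ 2)).
Proof.
  intros Hx; assert (Hw : 0 <= x ^ 2 < 1) by (split; nra).
  replace (2 * x ^ m * PSeries (milgram_ps m) (x ^ 2))
    with (x ^ m * (2 * PSeries (milgram_ps m) (x ^ 2))) by ring.
  rewrite PSeries_atan_Euler by trivial.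
  assert (Hd := is_derive_PSeries _ _ (Rbar_lt_CV_radius _ _ (CV_radius_atan_ps m) Hw)).
  assert (Hc : is_derive (fun x => PSeries (atan_ps m) (x ^ 2)) x
                 (scal (2 * x) (PSeries (PS_derive (atan_ps m)) (x ^ 2)))).
  { apply (is_derive_comp (PSeries (atan_ps m)) (fun x => x ^ 2)); trivial.
    auto_derive; trivial; ring. }
  assert (Hp : is_derive (fun x => x ^ S m) x (INR (S m) * x ^ m)).
  { auto_derive; trivial.
    change (match m with O => 1 | S _ => INR m + 1 end) with (INR (S m)); simpl; ring. }
  assert (H := is_derive_mult _ _ _ _ _ Hp Hc Rmult_comm).
  unfold plus, mult, scal in H; simpl in H; unfold mult in H; simpl in H.
  evar_last; [ exact H | simpl; ring ].
Qed.

Lemma is_derive_scal_atan_pow (c : R) (k : nat) (t : R) :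
  is_derive (fun t => c * atan t ^ S k) t (c * (INR (S k) * atan t ^ k * / (1 + t ^ 2))).
Proof.
  auto_derive; trivial.
  change (match k with O => 1 | S _ => INR k + 1 end) with (INR (S k)).
  simpl Nat.pred; unfold Rsqr; field; nra.
Qed.

(* Both sides vanish at 0 and have the derivative 2 x^m T(x^2), where T is
   the series [milgram_ps m] and (1 + w) T(w) is the series of the previous power of the arctangent. *)
Lemma atan_pow_PSeries (m : nat) (x : R) : 0 <= x < 1 ->
  x ^ S m * PSeries (atan_ps m) (x ^ 2) = 2 ^ S m / INR (fact (S m)) * atan x ^ S m.
Proof.
  revert x; induction m as [ | m IH ]; intros x [[Hx0 | <-] Hx1];
    try (rewrite atan_0, !pow_i by lia; ring).
  (* Base case and induction step share this reduction to the vanishing of the derivative of the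
     difference [f]. *)
  all: match goal with |- ?F = ?c * atan _ ^ S ?k =>
    set (f := fun t => t ^ S k * PSeries (atan_ps k) (t ^ 2) - c * atan t ^ S k);
    enough (E : f 0 = f x)
      by (unfold f in E; rewrite atan_0, !(pow_i (S k)) in E by lia; lra);
    apply eq_is_derive; trivial; intros t Ht;
    assert (Ht' : 0 <= t < 1) by lra;
    assert (Hw : 0 <= t ^ 2 < 1) by (split; nra);
    assert (Hd := is_derive_minus _ _ _ _ _ (is_derive_atan_ps k t Ht')
                    (is_derive_scal_atan_pow c k t));
    evar_last; [ exact Hd | ]; change (@zero R_NormedModule) with 0;
    unfold minus, plus, opp; cbn -[pow INR fact] end.
  - assert (E := PSeries_milgram_0 _ Hw).
    replace (PSeries (milgram_ps 0) (t ^ 2)) with (/ (1 + t ^ 2)).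
    + simpl; field; nra.
    + symmetry; apply (Rmult_eq_reg_l (1 + t ^ 2)); [ rewrite E; field; nra | nra ].
  (* Dividing by [1 + t^2] expresses the derivative through the previous power of the arctangent,
     known by induction. *)
  - assert (E := PSeries_milgram_S m _ Hw).
    replace (PSeries (milgram_ps (S m)) (t ^ 2)) with (PSeries (atan_ps m) (t ^ 2) / (1 + t ^ 2)).
    + replace (2 * t ^ S m * (PSeries (atan_ps m) (t ^ 2) / (1 + t ^ 2)))
        with (2 * (t ^ S m * PSeries (atan_ps m) (t ^ 2)) / (1 + t ^ 2)) by (field; nra).
      rewrite IH by trivial.
      rewrite (fact_simpl (S m)), mult_INR.
      pose proof (INR_fact_neq_0 (S m)); assert (INR (S (S m)) <> 0) by (apply not_0_INR; lia).
      rewrite <- (tech_pow_Rmult 2 (S m)).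
      field; repeat split; trivial; nra.
    + symmetry; apply (Rmult_eq_reg_l (1 + t ^ 2)); [ rewrite E; field; nra | nra ].
Qed.

(** The continuous extension of the quotient; the bare expression [atan x / x] evaluates to 0 at
    0. *)
Definition atanc (x : R) : R := if Req_EM_T x 0 then 1 else atan x / x.

Lemma atanc_neq_0 (x : R) : x <> 0 -> atanc x = atan x / x.
Proof. intros Hx; unfold atanc; now destruct (Req_EM_T x 0). Qed.

Lemma atanc_0 : atanc 0 = 1.
Proof. unfold atanc; now destruct (Req_EM_T 0 0). Qed.

Lemma continuous_atanc (x : R) : continuous atanc x.
Proof.
  destruct (Req_dec x 0) as [-> | Hx].
  - assert (Hd : is_derive atan 0 1).
    { evar_last; [ apply is_derive_atan | unfold Rsqr; field ]. }
    apply is_derive_Reals in Hd.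
    apply filterlim_locally; intros eps.
    destruct (Hd eps (cond_pos eps)) as [d Hd']; exists d; intros h Hh.
    change (Rabs (h - 0) < d) in Hh; rewrite Rminus_0_r in Hh.
    change (Rabs (atanc h - atanc 0) < eps); rewrite atanc_0.
    destruct (Req_dec h 0) as [-> | Hh0].
    + rewrite atanc_0, Rminus_eq_0, Rabs_R0; apply cond_pos.
    + rewrite atanc_neq_0 by trivial.
      specialize (Hd' h Hh0 Hh).
      now rewrite Rplus_0_l, atan_0, Rminus_0_r in Hd'.
  - apply continuous_ext_loc with (fun x => atan x / x).
    + exists (mkposreal _ (Rabs_pos_lt x Hx)); intros y Hy; symmetry; apply atanc_neq_0.
      intros ->; change (Rabs (0 - x) < Rabs x) in Hy.
      rewrite Rminus_0_l, Rabs_Ropp in Hy; lra.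
    + apply (ex_derive_continuous (fun x => atan x / x)); auto_derive; trivial.
Qed.

(** Away from 0, [x^(m+1)] is cancelled from the expansion of the arctangent power. At 0 the series
    reduces to its constant coefficient, given by [milgram_0]. *)
Lemma atanc_pow_PSeries (m : nat) (x : R) : 0 <= x < 1 ->
  2 ^ S m / INR (fact (S m)) * atanc x ^ S m = PSeries (atan_ps m) (x ^ 2).
Proof.
  intros Hx; destruct (Req_dec x 0) as [-> | Hx0].
  - rewrite atanc_0, pow1, pow_i, PSeries_0 by lia.
    unfold atan_ps, milgram_ps; rewrite milgram_0, fact_simpl, mult_INR.
    pose proof (INR_fact_neq_0 m); assert (INR (S m) <> 0) by (apply not_0_INR; lia).
    change (INR 0) with 0; simpl pow; field; split; trivial; lra.
  - rewrite atanc_neq_0 by trivial.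
    apply (Rmult_eq_reg_l (x ^ S m)); [ | now apply pow_nonzero ].
    rewrite atan_pow_PSeries by trivial.
    unfold Rdiv at 2; rewrite Rpow_mult_distr, pow_inv.
    field; split; [ apply INR_fact_neq_0 | now apply pow_nonzero ].
Qed.

(** * Binomial coefficients and series *)

(** Peeling off the first factor suits [gamma_coef], whose upper argument moves with [k]. *)
Lemma falling_S_l (z : R) (k : nat) : falling (z + 1) (S k) = (z + 1) * falling z k.
Proof.
  induction k as [ | k IH ]; [ simpl; ring | ].
  change (falling (z + 1) (S (S k))) with (falling (z + 1) (S k) * (z + 1 - INR (S k))).
  rewrite IH, S_INR; simpl; ring.
Qed.

Lemma gbinom_pascal (z : R) (k : nat) :
  gbinom (z + 1) (S k) = gbinom z (S k) + gbinom z k.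
Proof.
  unfold gbinom; rewrite falling_S_l, fact_simpl, mult_INR, S_INR.
  pose proof (INR_fact_neq_0 k); pose proof (INR_S_pos k); simpl; field; lra.
Qed.

Lemma gamma_coef_0 (r : nat) : gamma_coef r 0 = 1.
Proof. unfold gamma_coef, gbinom; simpl; field. Qed.

Lemma gamma_coef_S (r k : nat) :
  gamma_coef r (S k) = gamma_coef r k * ((INR r + INR k) / (INR k + 1)).
Proof.
  unfold gamma_coef, gbinom.
  replace (INR r + INR (S k) - 1) with ((INR r + INR k - 1) + 1) by (rewrite S_INR; ring).
  rewrite falling_S_l, fact_simpl, mult_INR, S_INR.
  pose proof (INR_fact_neq_0 k); pose proof (INR_S_pos k); field; lra.
Qed.

Lemma gamma_coef_pascal (r k : nat) :
  gamma_coef (S r) (S k) = gamma_coef r (S k) + gamma_coef (S r) k.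
Proof.
  unfold gamma_coef.
  replace (INR (S r) + INR (S k) - 1) with ((INR r + INR (S k) - 1) + 1) by (rewrite !S_INR; ring).
  rewrite gbinom_pascal; f_equal; f_equal; rewrite !S_INR; ring.
Qed.

Lemma gamma_coef_0_S (k : nat) : gamma_coef 0 (S k) = 0.
Proof.
  induction k as [ | k IH ]; rewrite gamma_coef_S; [ simpl; field | rewrite IH; ring ].
Qed.

(** Double induction along Pascal's rule, which closes because
    [(k+2)^r + (k+1)^(r+1) <= (k+2)^(r+1)]. *)
Lemma gamma_coef_S_le (r k : nat) : 0 <= gamma_coef (S r) k <= (INR k + 1) ^ r.
Proof.
  revert k; induction r as [ | r IH ]; intros k.
  - induction k as [ | k IHk ]; simpl; [ rewrite gamma_coef_0; lra | ].
    rewrite gamma_coef_pascal, gamma_coef_0_S; simpl in IHk; lra.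
  - induction k as [ | k IHk ].
    + rewrite gamma_coef_0; change (INR 0) with 0; rewrite Rplus_0_l, pow1; lra.
    + rewrite gamma_coef_pascal; specialize (IH (S k)).
      pose proof (INR_S_pos k).
      split; [ lra | ].
      apply Rle_trans with ((INR (S k) + 1) ^ r + (INR k + 1) * (INR k + 1) ^ r).
      * apply Rplus_le_compat; [ apply IH | apply IHk ].
      * assert ((INR k + 1) ^ r <= (INR (S k) + 1) ^ r)
          by (apply pow_incr; rewrite S_INR; lra).
        rewrite S_INR in *; simpl; nra.
Qed.

Lemma pow_weight_mono (k m n : nat) : (m <= n)%nat -> (INR k + 1) ^ m <= (INR k + 1) ^ n.
Proof. intros H; apply Rle_pow; trivial; pose proof (pos_INR k); lra. Qed.

Lemma Rabs_gamma_coef_le (r d k : nat) : (r <= d + 1)%nat ->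
  Rabs (gamma_coef r k) <= (INR k + 1) ^ d.
Proof.
  intros Hr; destruct r as [ | r ].
  - assert (H := pow_weight_mono k 0 d ltac:(lia)); simpl in H.
    apply Rle_trans with (2 := H).
    destruct k; [ rewrite gamma_coef_0, Rabs_R1 | rewrite gamma_coef_0_S, Rabs_R0 ]; lra.
  - destruct (gamma_coef_S_le r k) as [H0 H1].
    rewrite Rabs_pos_eq by trivial.
    apply Rle_trans with (1 := H1), pow_weight_mono; lia.
Qed.

Definition binom_ps (r k : nat) : R := (-1) ^ k * gamma_coef r k.

Lemma CV_radius_binom_ps (r : nat) : Rbar_le 1 (CV_radius (binom_ps r)).
Proof.
  apply (CV_radius_ge_1 _ 1 r); intros n; unfold binom_ps.
  rewrite Rabs_mult, Rabs_pow_m1, !Rmult_1_l; apply Rabs_gamma_coef_le; lia.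
Qed.

(** By Pascal's rule, multiplying the series by [1 + w] lowers [r] by one. *)
Lemma PSeries_binom_ps (r : nat) (w : R) : 0 <= w < 1 ->
  PSeries (binom_ps r) w = / (1 + w) ^ r.
Proof.
  intros Hw; induction r as [ | r IH ].
  (* The product [w * 0] stands for the tail after the constant term, all of whose coefficients
     vanish. *)
  - replace (PSeries (binom_ps 0) w) with (PSeries (binom_ps 0) w - w * 0) by ring.
    rewrite <- (PSeries_const_0 w).
    rewrite (PSeries_decr_1 (binom_ps 0)) by
      (apply CV_radius_inside, Rbar_lt_CV_radius; trivial; apply CV_radius_binom_ps).
    rewrite (PSeries_ext (PS_decr_1 (binom_ps 0)) (fun _ => 0)).
    + unfold binom_ps; rewrite gamma_coef_0; simpl; field.
    + intros n; unfold PS_decr_1, binom_ps; rewrite gamma_coef_0_S; ring.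
  - apply (Rmult_eq_reg_l (1 + w)); [ | lra ].
    rewrite PSeries_1p_mult by
      (apply CV_radius_inside, Rbar_lt_CV_radius; trivial; apply CV_radius_binom_ps).
    rewrite (PSeries_ext _ (binom_ps r)).
    + rewrite IH; simpl; field; split; [ apply pow_nonzero | ]; lra.
    + intros n; unfold PS_plus, PS_incr_1, binom_ps.
      destruct n as [ | n ].
      * rewrite !gamma_coef_0; unfold plus, zero; simpl; ring.
      * rewrite gamma_coef_pascal; unfold plus; simpl; ring.
Qed.

(** * Comparison series and an alternating series test *)

Lemma ex_series_inv_pow_3_2 : ex_series (fun n => / ((INR n + 1) * sqrt (INR n + 1))).
Proof.
  assert (Htel : ex_series (fun n => / sqrt (INR n + 1) - / sqrt (INR (S n) + 1))).
  { exists 1.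
    change (is_lim_seq (sum_n (fun n => / sqrt (INR n + 1) - / sqrt (INR (S n) + 1))) 1).
    apply is_lim_seq_ext with (fun n => 1 - / sqrt (INR (S n) + 1)).
    - induction n as [ | n IH ].
      + rewrite sum_O; change (INR 0) with 0; rewrite Rplus_0_l, sqrt_1, Rinv_1; reflexivity.
      + rewrite sum_n_S, <- IH; ring.
    - replace (Finite 1) with (Finite (1 - 0)) by (f_equal; ring).
      apply is_lim_seq_minus'; [ apply is_lim_seq_const | ].
      apply is_lim_seq_ext with (fun n => / sqrt (INR (S (S n)))).
      + intros n; now rewrite (S_INR (S n)).
      + apply (is_lim_seq_incr_1 (fun n => / sqrt (INR (S n)))).
        apply (is_lim_seq_incr_1 (fun n => / sqrt (INR n))).
        apply (is_lim_seq_inv _ p_infty); [ | easy ].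
        apply (filterlim_comp _ _ _ INR sqrt _ (Rbar_locally p_infty));
          [ apply is_lim_seq_INR | apply filterlim_sqrt_p ]. }
  apply (ex_series_le (V := R_CompleteNormedModule)) with (fun n => 4 * (/ sqrt (INR n + 1) - / sqrt (INR (S n) + 1))).
  - intros n.
    assert (Hn := INR_S_pos n).
    assert (Hs : 0 < sqrt (INR n + 1)) by (apply sqrt_lt_R0; lra).
    assert (Hs' : 0 < sqrt (INR (S n) + 1)) by (apply sqrt_lt_R0; rewrite S_INR; lra).
    assert (E := sqrt_sqrt (INR n + 1) ltac:(lra)).
    assert (E' := sqrt_sqrt (INR (S n) + 1) ltac:(rewrite S_INR; lra)).
    rewrite S_INR in E' at 3.
    change (Rabs (/ ((INR n + 1) * sqrt (INR n + 1)))
      <= 4 * (/ sqrt (INR n + 1) - / sqrt (INR (S n) + 1))).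
    rewrite Rabs_pos_eq by (left; apply Rinv_0_lt_compat, Rmult_lt_0_compat; lra).
    set (s := sqrt (INR n + 1)) in *; set (s' := sqrt (INR (S n) + 1)) in *.
    assert (Hlt : s < s') by (apply sqrt_lt_1; rewrite ?S_INR; lra).
    (* As [s'^2 - s^2 = 1], the telescoping term is [1 / (s s' (s + s'))]. The ratio [s' / s] is at
       most [sqrt 2 < 3/2], so [s' (s + s') <= 15/4 s^2], whence the constant 4. *)
    assert (Hle : s' <= 3 / 2 * s).
    { assert (INR 0 <= INR n) by apply pos_INR; simpl in *.
      apply Rsqr_incr_0; unfold Rsqr; nra. }
    rewrite <- E.
    replace (/ s - / s') with (/ (s * s' * (s + s'))).
    + apply (Rmult_le_reg_r (s * s * s * (s * s' * (s + s')))).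
      * repeat apply Rmult_lt_0_compat; lra.
      * replace (/ (s * s * s) * (s * s * s * (s * s' * (s + s')))) with (s * (s' * (s + s')))
          by (field; lra).
        replace (4 * / (s * s' * (s + s')) * (s * s * s * (s * s' * (s + s'))))
          with (s * (4 * (s * s))) by (field; lra).
        apply Rmult_le_compat_l; nra.
    + replace (/ s - / s') with ((s' * s' - s * s) / (s * s' * (s + s'))) by (field; lra).
      replace (s' * s' - s * s) with 1 by lra; field; lra.
  - apply (ex_series_scal_l (V := R_NormedModule)), Htel.
Qed.

Lemma ex_series_inv_pow_2 : ex_series (fun n => / (INR n + 1) ^ 2).
Proof.
  apply (ex_series_le (V := R_CompleteNormedModule)) with (2 := ex_series_inv_pow_3_2); intros n.
  assert (Hn := INR_S_pos n).
  assert (Hs : 0 < sqrt (INR n + 1)) by (apply sqrt_lt_R0; lra).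
  change (Rabs (/ (INR n + 1) ^ 2) <= / ((INR n + 1) * sqrt (INR n + 1))).
  rewrite Rabs_pos_eq by (left; apply Rinv_0_lt_compat, pow_lt; lra).
  apply Rinv_le_contravar; [ now apply Rmult_lt_0_compat | ].
  pose proof (sqrt_S_le n); simpl; nra.
Qed.

(* Twice the partial sum equals, up to boundary terms, the partial sum of the absolutely
   convergent series of the (-1)^n (v_n - v_(n+1)). *)
Lemma ex_series_alternating (v : nat -> R) :
  is_lim_seq v 0 -> ex_series (fun n => Rabs (v n - v (S n))) ->
  ex_series (fun n => (-1) ^ n * v n).
Proof.
  intros Hv Hd.
  assert (Hs : ex_series (fun n => (-1) ^ n * (v n - v (S n)))).
  { apply ex_series_Rabs; apply ex_series_ext with (2 := Hd).
    intros n; rewrite Rabs_mult, Rabs_pow_m1; symmetry; apply Rmult_1_l. }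
  destruct Hs as [l Hl].
  exists ((l + v O - 0) / 2).
  change (is_lim_seq (sum_n (fun n => (-1) ^ n * (v n - v (S n)))) l) in Hl.
  change (is_lim_seq (sum_n (fun n => (-1) ^ n * v n)) ((l + v O - 0) / 2)).
  apply is_lim_seq_ext with (fun n =>
    (sum_n (fun n => (-1) ^ n * (v n - v (S n))) n + v O - (-1) ^ S n * v (S n)) * / 2).
  - induction n as [ | n IH ].
    + rewrite !sum_O; simpl; field.
    + rewrite !sum_n_S, <- IH; simpl; field.
  - unfold Rdiv; apply is_lim_seq_mult'; [ | apply is_lim_seq_const ].
    apply is_lim_seq_minus'.
    + apply is_lim_seq_plus'; [ exact Hl | apply is_lim_seq_const ].
    + apply (is_lim_seq_incr_1 (fun n => (-1) ^ n * v n)).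
      apply is_lim_seq_abs_0, is_lim_seq_ext with (fun n => Rabs (v n)).
      * intros n; rewrite Rabs_mult, Rabs_pow_m1; ring.
      * apply (proj1 (is_lim_seq_abs_0 v)), Hv.
Qed.

(** * The integral *)

Lemma Rabs_pow_ln (m q : nat) (x : R) : 0 <= x <= 1 ->
  Rabs (pow_ln m q x) = (-1) ^ q * pow_ln m q x.
Proof.
  intros Hx; unfold pow_ln.
  rewrite Rabs_mult, <- !RPow_abs, (Rabs_pos_eq x), Rabs_left1
    by (trivial; try lra; now apply ln_01_nonpos).
  replace (- ln x) with ((-1) * ln x) by ring; rewrite Rpow_mult_distr; ring.
Qed.

(** [pow_ln] has constant sign on [[0, 1]], so the integral of its absolute value is known
    exactly. *)
Lemma Rabs_RInt_le_pow_ln (f : R -> R) (c : R) (m q : nat) :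
  (1 <= m)%nat -> (forall x, 0 <= x <= 1 -> continuous f x) ->
  (forall x, 0 <= x <= 1 -> Rabs (f x) <= c * Rabs (pow_ln m q x)) ->
  Rabs (RInt f 0 1) <= c * (INR (fact q) / (INR m + 1) ^ (q + 1)).
Proof.
  intros Hm Hc Hf.
  assert (HI : is_RInt (fun x => c * (-1) ^ q * pow_ln m q x) 0 1
                 (c * (-1) ^ q * RInt (pow_ln m q) 0 1)).
  { apply (is_RInt_scal (V := R_NormedModule)), (RInt_correct (V := R_CompleteNormedModule)),
      ex_RInt_pow_ln, Hm. }
  apply Rle_trans with (RInt (fun x => c * (-1) ^ q * pow_ln m q x) 0 1).
  - apply Rle_trans with (RInt (fun x => Rabs (f x)) 0 1).
    + apply abs_RInt_le; [ lra | now apply ex_RInt_continuous_01 ].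
    + apply RInt_le; [ lra | | eexists; exact HI | ].
      * apply ex_RInt_continuous_01; intros x Hx; now apply continuous_Rabs_comp, Hc.
      * intros x Hx; rewrite Rmult_assoc, <- Rabs_pow_ln by lra; apply Hf; lra.
  - right; rewrite (is_RInt_unique _ _ _ _ HI), RInt_pow_ln by trivial.
    replace (c * (-1) ^ q * ((-1) ^ q * INR (fact q) / (INR m + 1) ^ (q + 1)))
      with (((-1) ^ q * (-1) ^ q) * (c * (INR (fact q) / (INR m + 1) ^ (q + 1))))
      by (unfold Rdiv; ring).
    rewrite <- Rpow_mult_distr; replace (-1 * -1) with 1 by ring; rewrite pow1; ring.
Qed.

Lemma pow_ln_mult_pow (m q j : nat) (x : R) : pow_ln m q x * x ^ j = pow_ln (m + j) q x.
Proof. unfold pow_ln; rewrite pow_add; ring. Qed.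

Lemma inner_term_atan_ps (a m q k n : nat) :
  inner_term a (S m) q k n = atan_ps m n * / INR (a + 2 * k + 2 * n + 1) ^ (q + 1).
Proof.
  unfold inner_term, atan_ps, milgram_ps; rewrite Nat.sub_succ, Nat.sub_0_r.
  assert (Hm := half_S_le m n); assert (Hn := INR_S_pos n).
  field; split; [ apply pow_nonzero, not_0_INR; lia | lra ].
Qed.

(** The coefficients [atan_ps] are of order [1 / sqrt (n+1)]; a single factor of the power in the
    denominator brings this to [(n+1)^(-3/2)]. *)
Lemma ex_series_inner_term (a m q k : nat) : ex_series (inner_term a (S m) q k).
Proof.
  destruct (Rabs_atan_ps_le m) as [C [HC H]].
  apply (ex_series_le (V := R_CompleteNormedModule))
    with (fun n => C * / ((INR n + 1) * sqrt (INR n + 1))).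
  - intros n; change (Rabs (inner_term a (S m) q k n) <= C * / ((INR n + 1) * sqrt (INR n + 1))).
    assert (Hn := INR_S_pos n).
    assert (Hd : INR n + 1 <= INR (a + 2 * k + 2 * n + 1) ^ (q + 1)).
    { rewrite <- S_INR; apply Rle_trans with (INR (a + 2 * k + 2 * n + 1)).
      - apply le_INR; lia.
      - rewrite <- (pow_1 (INR (a + 2 * k + 2 * n + 1))) at 1.
        apply Rle_pow; [ | lia ].
        change 1 with (INR 1); apply le_INR; lia. }
    rewrite inner_term_atan_ps, Rabs_mult, Rabs_inv, (Rabs_pos_eq (_ ^ _)) by lra.
    rewrite Rinv_mult, (Rmult_comm (/ (INR n + 1))), <- Rmult_assoc.
    apply Rmult_le_compat; [ apply Rabs_pos | | apply H | ].
    + left; apply Rinv_0_lt_compat; lra.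
    + apply Rinv_le_contravar; lra.
  - apply (ex_series_scal_l (V := R_NormedModule)), ex_series_inv_pow_3_2.
Qed.

Definition numerator (a p q : nat) (x : R) : R := pow_ln a q x * atanc x ^ p.

Lemma continuous_numerator (a p q : nat) (x : R) :
  (1 <= a)%nat -> 0 <= x -> continuous (numerator a p q) x.
Proof.
  intros Ha Hx; apply continuous_Rmult; [ now apply continuous_pow_ln | ].
  apply continuous_pow_comp, continuous_atanc.
Qed.

(** First use of the Abel principle: the factor [x^(2k)] is merged into [pow_ln], and the
    convergence of the inner series turns its Abel sum into its sum. The prefactor is
    [(-1)^q q! / c]. *)
Lemma moment_numerator (a m q k : nat) : (1 <= a)%nat ->
  moment (numerator a (S m) q) k = prefactor (S m) q * Series (inner_term a (S m) q k).
Proof.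
  intros Ha.
  set (c := 2 ^ S m / INR (fact (S m))).
  assert (Hab := abel_sum_moments (atan_ps m) (pow_ln (a + 2 * k) q)
    (fun x => c * atanc x ^ S m) (CV_radius_atan_ps m)
    ltac:(intros x Hx; apply continuous_pow_ln; [ lia | lra ])
    ltac:(intros x _; apply (continuous_Rmult (fun _ => c));
          [ apply continuous_const | apply continuous_pow_comp, continuous_atanc ])
    ltac:(intros x Hx; now apply atanc_pow_PSeries)).
  apply (is_abel_sum_ext _ (fun n => ((-1) ^ q * INR (fact q)) * inner_term a (S m) q k n)) in Hab.
  - apply is_abel_sum_Series in Hab;
      [ | apply (ex_series_scal_l (V := R_NormedModule)), ex_series_inner_term ].
    rewrite Series_scal_l in Hab.
    assert (Hc : c <> 0).
    { apply Rmult_integral_contrapositive_currified;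
        [ apply pow_nonzero; lra | apply Rinv_neq_0_compat, INR_fact_neq_0 ]. }
    assert (HI : RInt (fun x => pow_ln (a + 2 * k) q x * (c * atanc x ^ S m)) 0 1
                 = c * moment (numerator a (S m) q) k).
    { apply is_RInt_unique.
      apply is_RInt_ext with (fun x => scal c (numerator a (S m) q x * x ^ (2 * k))).
      - intros x _; unfold numerator; rewrite <- pow_ln_mult_pow.
        change (c * (pow_ln a q x * atanc x ^ S m * x ^ (2 * k))
                = pow_ln a q x * x ^ (2 * k) * (c * atanc x ^ S m)); ring.
      - apply (is_RInt_scal (V := R_NormedModule)), is_RInt_moment.
        intros x Hx; apply continuous_numerator; trivial; lra. }
    rewrite HI in Hab.
    apply (Rmult_eq_reg_l c); trivial; rewrite <- Hab.
    unfold prefactor, c; field; split; [ apply pow_nonzero; lra | apply INR_fact_neq_0 ].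
  - intros n; rewrite inner_term_atan_ps; unfold moment.
    rewrite (RInt_ext _ (pow_ln (a + 2 * k + 2 * n) q)) by (intros; apply pow_ln_mult_pow).
    rewrite RInt_pow_ln, (plus_INR _ 1) by lia; simpl (INR 1).
    unfold Rdiv; ring.
Qed.

Lemma prefactor_neq_0 (p q : nat) : prefactor p q <> 0.
Proof.
  unfold prefactor, Rdiv; repeat apply Rmult_integral_contrapositive_currified;
    try apply INR_fact_neq_0; try apply Rinv_neq_0_compat; apply pow_nonzero; lra.
Qed.

Lemma one_plus_sqr_pow_pos (r : nat) (x : R) : 0 < (1 + x ^ 2) ^ r.
Proof. apply pow_lt; nra. Qed.

Lemma integrand_numerator (a p q r : nat) (x : R) : 0 < x ->
  integrand a p q r x = numerator a p q x * / (1 + x ^ 2) ^ r.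
Proof.
  intros Hx; unfold integrand, numerator, pow_ln; rewrite atanc_neq_0 by lra; reflexivity.
Qed.

Lemma continuous_inv_one_plus_sqr_pow (r : nat) (x : R) :
  continuous (fun x => / (1 + x ^ 2) ^ r) x.
Proof.
  apply (ex_derive_continuous (fun x => / (1 + x ^ 2) ^ r)); auto_derive.
  pose proof (one_plus_sqr_pow_pos r x); simpl in *; lra.
Qed.

Lemma RInt_integrand (a p q r : nat) :
  RInt (integrand a p q r) 0 1 = RInt (fun x => numerator a p q x * / (1 + x ^ 2) ^ r) 0 1.
Proof.
  apply RInt_ext; intros x; rewrite Rmin_left, Rmax_right by lra; intros Hx.
  apply integrand_numerator; lra.
Qed.

Lemma ex_RInt_integrand (a p q r : nat) : (1 <= a)%nat -> ex_RInt (integrand a p q r) 0 1.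
Proof.
  intros Ha.
  apply ex_RInt_ext with (fun x => numerator a p q x * / (1 + x ^ 2) ^ r).
  - intros x; rewrite Rmin_left, Rmax_right by lra; intros Hx.
    symmetry; apply integrand_numerator; lra.
  - apply ex_RInt_continuous_01; intros x Hx; apply continuous_Rmult.
    + apply continuous_numerator; trivial; lra.
    + apply continuous_inv_one_plus_sqr_pow.
Qed.

Lemma outer_term_moment (a m q r k : nat) : (1 <= a)%nat ->
  outer_term a (S m) q r k
  = / prefactor (S m) q * (binom_ps r k * moment (numerator a (S m) q) k).
Proof.
  intros Ha; rewrite moment_numerator by trivial; unfold outer_term, binom_ps.
  field; apply prefactor_neq_0.
Qed.

(** Second use of the Abel principle, now with the binomial series and the moments just
    evaluated. *)
Lemma abel_sum_outer_term (a m q r : nat) : (1 <= a)%nat ->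
  is_abel_sum (outer_term a (S m) q r)
    (/ prefactor (S m) q * RInt (integrand a (S m) q r) 0 1).
Proof.
  intros Ha.
  apply is_abel_sum_ext
    with (fun k => / prefactor (S m) q * (binom_ps r k * moment (numerator a (S m) q) k)).
  - intros k; symmetry; now apply outer_term_moment.
  - apply is_abel_sum_scal; rewrite RInt_integrand.
    apply (abel_sum_moments (binom_ps r) (numerator a (S m) q)).
    + apply CV_radius_binom_ps.
    + intros x Hx; apply continuous_numerator; trivial; lra.
    + intros x _; apply continuous_inv_one_plus_sqr_pow.
    + intros x Hx; symmetry; apply PSeries_binom_ps; split; nra.
Qed.

(** * Decay of the moments and convergence of the outer series *)

Lemma Rabs_numerator_le (a p q : nat) :
  exists M, 0 < M /\ forall x, 0 <= x <= 1 ->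
    Rabs (numerator a p q x) <= M * Rabs (pow_ln a q x).
Proof.
  destruct (bounded_continuous_01 (fun x => atanc x ^ p)) as [M [HM0 HM]].
  - intros x _; apply continuous_pow_comp, continuous_atanc.
  - exists M; split; trivial; intros x Hx; unfold numerator.
    rewrite Rabs_mult, Rmult_comm; apply Rmult_le_compat_r; [ apply Rabs_pos | now apply HM ].
Qed.

Lemma inv_pow_weight_le (a k d : nat) :
  / (INR (a + 2 * k) + 1) ^ d <= / (INR k + 1) ^ d.
Proof.
  assert (Hk := INR_S_pos k).
  apply Rinv_le_contravar; [ now apply pow_lt | ].
  apply pow_incr; split; [ lra | ].
  rewrite plus_INR, mult_INR; simpl INR.
  pose proof (pos_INR a); pose proof (pos_INR k); lra.
Qed.

(** From [x^2 = exp (2 ln x) >= 1 + 2 ln x]. *)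
Lemma one_minus_sqr_le_ln (x : R) : 0 < x <= 1 -> Rabs (1 - x ^ 2) <= 2 * Rabs (ln x).
Proof.
  intros Hx; rewrite Rabs_pos_eq by nra.
  rewrite Rabs_left1 by (apply ln_01_nonpos; lra).
  assert (H := exp_ineq1_le (2 * ln x)).
  replace (exp (2 * ln x)) with (x ^ 2) in H; [ lra | ].
  replace (2 * ln x) with (ln x + ln x) by ring.
  rewrite exp_plus, exp_ln by lra; ring.
Qed.

(** Consecutive moments differ by a factor [1 - x^2] under the integral. Bounding it by [2 |ln x|]
    raises the power of the logarithm by one, which gains a further factor of order [1 / (k+1)]. *)
Lemma Rabs_moment_numerator_le (a p q : nat) : (1 <= a)%nat ->
  exists K, 0 < K /\ forall k,
    Rabs (moment (numerator a p q) k) <= K * / (INR k + 1) ^ (q + 1) /\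
    Rabs (moment (numerator a p q) k - moment (numerator a p q) (S k))
      <= K * / (INR k + 1) ^ (q + 2).
Proof.
  intros Ha; destruct (Rabs_numerator_le a p q) as [M [HM0 HM]].
  assert (Hfq := INR_fact_lt_0 q); assert (Hfq' := INR_fact_lt_0 (S q)).
  assert (Hnum : forall x, 0 <= x <= 1 -> continuous (numerator a p q) x).
  { intros x Hx; apply continuous_numerator; trivial; lra. }
  exists (M * INR (fact q) + 2 * M * INR (fact (S q))); split; [ nra | ].
  intros k.
  assert (Hw : forall d, 0 < / (INR k + 1) ^ d).
  { intros d; apply Rinv_0_lt_compat, pow_lt, INR_S_pos. }
  split.
  - apply Rle_trans with (M * (INR (fact q) / (INR (a + 2 * k) + 1) ^ (q + 1))).
    + apply Rabs_RInt_le_pow_ln; [ lia | | ].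
      * intros x Hx; apply continuous_Rmult; [ now apply Hnum | apply continuous_pow ].
      * intros x Hx; rewrite <- pow_ln_mult_pow, !Rabs_mult, <- Rmult_assoc.
        apply Rmult_le_compat_r; [ apply Rabs_pos | now apply HM ].
    + pose proof (inv_pow_weight_le a k (q + 1)); specialize (Hw (q + 1)%nat).
      apply Rle_trans with (M * INR (fact q) * / (INR k + 1) ^ (q + 1)).
      * unfold Rdiv; rewrite <- Rmult_assoc; apply Rmult_le_compat_l; nra.
      * apply Rmult_le_compat_r; nra.
  - assert (HI := is_RInt_minus _ _ _ _ _ _ (is_RInt_moment _ Hnum k) (is_RInt_moment _ Hnum (S k))).
    unfold minus, plus, opp in HI; simpl plus in HI; simpl opp in HI.
    apply is_RInt_ext with (g := fun x => numerator a p q x * x ^ (2 * k) * (1 - x ^ 2)) in HI.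
    2: { intros x _; replace (2 * S k)%nat with (2 * k + 2)%nat by lia.
         rewrite pow_add; simpl; ring. }
    change (is_RInt (fun x => numerator a p q x * x ^ (2 * k) * (1 - x ^ 2)) 0 1
      (moment (numerator a p q) k - moment (numerator a p q) (S k))) in HI.
    rewrite <- (is_RInt_unique _ _ _ _ HI).
    apply Rle_trans with (2 * M * (INR (fact (S q)) / (INR (a + 2 * k) + 1) ^ (S q + 1))).
    + apply Rabs_RInt_le_pow_ln; [ lia | | ].
      * intros x Hx; apply continuous_Rmult;
          [ apply continuous_Rmult; [ now apply Hnum | apply continuous_pow ] | ].
        apply (ex_derive_continuous (fun x => 1 - x ^ 2)); auto_derive; trivial.
      (* The point 0 is separate: there [ln] is 0 by convention and cannot bound [1 - x^2], but both
         sides vanish because [1 <= a]. *)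
      * intros x [[Hx0 | <-] Hx1].
        -- rewrite <- pow_ln_mult_pow, !Rabs_mult.
           replace (Rabs (pow_ln a (S q) x)) with (Rabs (pow_ln a q x) * Rabs (ln x))
             by (rewrite <- Rabs_mult; f_equal; unfold pow_ln; simpl; ring).
           replace (2 * M * (Rabs (pow_ln a q x) * Rabs (ln x) * Rabs (x ^ (2 * k))))
             with (M * Rabs (pow_ln a q x) * Rabs (x ^ (2 * k)) * (2 * Rabs (ln x))) by ring.
           apply Rmult_le_compat; try apply Rabs_pos.
           ++ apply Rmult_le_pos; apply Rabs_pos.
           ++ apply Rmult_le_compat_r; [ apply Rabs_pos | apply HM; lra ].
           ++ apply one_minus_sqr_le_ln; lra.
        -- unfold numerator; rewrite !pow_ln_0, !Rmult_0_l, Rabs_R0 by lia; lra.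
    + replace (S q + 1)%nat with (q + 2)%nat by lia.
      pose proof (inv_pow_weight_le a k (q + 2)); specialize (Hw (q + 2)%nat).
      apply Rle_trans with (2 * M * INR (fact (S q)) * / (INR k + 1) ^ (q + 2)).
      * unfold Rdiv; rewrite <- Rmult_assoc; apply Rmult_le_compat_l; nra.
      * apply Rmult_le_compat_r; nra.
Qed.

Lemma ex_series_binom_moment (a p q r : nat) : (1 <= a)%nat -> (r <= q + 1)%nat ->
  ex_series (fun k => binom_ps r k * moment (numerator a p q) k).
Proof.
  intros Ha Hr; destruct (Rabs_moment_numerator_le a p q Ha) as [K [HK H]].
  set (mu := moment (numerator a p q)) in *.
  apply ex_series_ext with (fun k => (-1) ^ k * (gamma_coef r k * mu k)).
  { intros k; symmetry; apply Rmult_assoc. }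
  assert (Hg : forall k, 0 <= Rabs (gamma_coef r k) <= (INR k + 1) ^ q).
  { intros k; split; [ apply Rabs_pos | now apply Rabs_gamma_coef_le ]. }
  apply ex_series_alternating.
  - apply is_lim_seq_abs_0.
    apply is_lim_seq_le_le with (u := fun _ => 0) (w := fun k => K * / INR (S k)).
    + intros k; split; [ apply Rabs_pos | ].
      assert (Hk := INR_S_pos k).
      rewrite Rabs_mult, S_INR.
      apply Rle_trans with ((INR k + 1) ^ q * (K * / (INR k + 1) ^ (q + 1))).
      * apply Rmult_le_compat; try apply Rabs_pos; [ apply Hg | apply H ].
      * right; rewrite pow_add; field; split; [ | apply pow_nonzero ]; lra.
    + apply is_lim_seq_const.
    + replace (Finite 0) with (Rbar_mult K 0) by (simpl; f_equal; ring).
      apply is_lim_seq_scal_l, (is_lim_seq_incr_1 (fun k => / INR k)).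
      apply (is_lim_seq_inv _ p_infty); [ apply is_lim_seq_INR | easy ].
  - apply (ex_series_le (V := R_CompleteNormedModule))
      with (fun k => (K + K * (INR q + 1)) * / (INR k + 1) ^ 2);
      [ | apply (ex_series_scal_l (V := R_NormedModule)), ex_series_inv_pow_2 ].
    intros k.
    assert (Hk := INR_S_pos k).
    change (Rabs (Rabs (gamma_coef r k * mu k - gamma_coef r (S k) * mu (S k)))
      <= (K + K * (INR q + 1)) * / (INR k + 1) ^ 2).
    rewrite Rabs_Rabsolu, gamma_coef_S.
    (* The ratio of consecutive coefficients is [1 + (r-1)/(k+1)]. Both parts of the bracket are of
       order [(k+1)^(-q-2)], against a coefficient of order at most [(k+1)^q]. *)
    replace (gamma_coef r k * mu k
             - gamma_coef r k * ((INR r + INR k) / (INR k + 1)) * mu (S k))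
      with (gamma_coef r k * ((mu k - mu (S k)) + - (mu (S k) * ((INR r - 1) * / (INR k + 1)))))
      by (field; lra).
    assert (Hr1 : Rabs (INR r - 1) <= INR q + 1).
    { assert (Hrq := le_INR _ _ Hr); rewrite plus_INR in Hrq; simpl in Hrq.
      pose proof (pos_INR r); pose proof (pos_INR q); apply Rabs_le; lra. }
    assert (Hw : 0 < / (INR k + 1)) by now apply Rinv_0_lt_compat.
    assert (Hmu : Rabs (mu (S k)) <= K * / (INR k + 1) ^ (q + 1)).
    { apply Rle_trans with (1 := proj1 (H (S k))), Rmult_le_compat_l; [ lra | ].
      apply Rinv_le_contravar; [ now apply pow_lt | ].
      apply pow_incr; rewrite S_INR; lra. }
    assert (Hq := pow_lt (INR k + 1) q Hk).
    apply Rle_trans with ((INR k + 1) ^ q * (K * / (INR k + 1) ^ (q + 2)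
      + K * / (INR k + 1) ^ (q + 1) * ((INR q + 1) * / (INR k + 1)))).
    + rewrite Rabs_mult; apply Rmult_le_compat; try apply Rabs_pos; [ apply Hg | ].
      apply Rle_trans with (1 := Rabs_triang _ _), Rplus_le_compat; [ apply H | ].
      rewrite Rabs_Ropp, Rabs_mult, (Rabs_mult (_ - _)), (Rabs_pos_eq (/ _)) by lra.
      apply Rmult_le_compat; try apply Rabs_pos; trivial.
      * apply Rmult_le_pos; [ apply Rabs_pos | lra ].
      * apply Rmult_le_compat_r; lra.
    + right; rewrite !pow_add; field; split; [ | apply pow_nonzero ]; lra.
Qed.

(** Convergence of the outer series is established for [r <= q + 1]; for general [r] the identity is
    given with the ordinary sum whenever the series converges, and with the Abel sum
    unconditionally. *)
Theorem theorem1 (a p q r : nat) (ha : (1 <= a)%nat) (hp : (1 <= p)%nat) :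
  ex_RInt (integrand a p q r) 0 1 /\
  (forall k : nat, ex_series (inner_term a p q k)) /\
  ((r <= q + 1)%nat -> ex_series (outer_term a p q r)) /\
  (ex_series (outer_term a p q r) ->
     RInt (integrand a p q r) 0 1 = prefactor p q * Series (outer_term a p q r)) /\
  (exists l : R,
     is_abel_sum (outer_term a p q r) l /\
     RInt (integrand a p q r) 0 1 = prefactor p q * l).
Proof.
  destruct p as [ | m ]; [ lia | ].
  assert (Hp := prefactor_neq_0 (S m) q).
  assert (Habel := abel_sum_outer_term a m q r ha).
  repeat split.
  - now apply ex_RInt_integrand.
  - intros k; apply ex_series_inner_term.
  - intros Hr.
    apply ex_series_ext
      with (fun k => / prefactor (S m) q * (binom_ps r k * moment (numerator a (S m) q) k)).
    + intros k; symmetry; now apply outer_term_moment.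
    + now apply (ex_series_scal_l (V := R_NormedModule)), ex_series_binom_moment.
  - intros Hex; rewrite (is_abel_sum_Series _ _ Habel Hex).
    now rewrite <- Rmult_assoc, Rinv_r, Rmult_1_l.
  - eexists; split; [ exact Habel | ].
    now rewrite <- Rmult_assoc, Rinv_r, Rmult_1_l.
Qed.
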